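(* Let $n_1,\ldots,n_s$ be distinct positive integers and $r_1,\ldots,r_s$ positive integers such that $r_i\geq 3$ for some $i\in\{1,\ldots,s\}$. Then the complete $k$-partite graph $K_{r_1.n_1,\ldots,r_s.n_s}$ (with $k=\sum_i r_i$) is $S$-determined.
   Context: For a simple graph $G$ with adjacency matrix $A(G)$, the Seidel matrix is $S(G)=J-I-2A(G)$, where $I$ is the identity matrix and $J$ the all-ones matrix. For $U\subset V(G)$, Seidel switching with respect to $U$ deletes all edges between $U$ and $V(G)\setminus U$ and adds all non-edges between them; two graphs are switching equivalent if one is obtained from the other by Seidel switching. A graph $G$ is $S$-determined (Seidel determined up to switching) if every graph with the same Seidel spectrum as $G$ is switching equivalent to a graph isomorphic to $G$. $K_{r_1.n_1,\ldots,r_s.n_s}$ denotes the complete multipartite graph having exactly $r_i$ parts of size $n_i$ for each $i$; two vertices are adjacent iff they lie in different parts. *)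

(* Defs.v *)
From mathcomp Require Import all_boot all_order all_algebra all_field.

Set Implicit Arguments.
Unset Strict Implicit.
Unset Printing Implicit Defensive.

Import Order.TTheory GRing.Theory Num.Theory.
Local Open Scope ring_scope.

Record sgraph (V : finType) := SGraph {
  adj :> rel V;
  adj_sym : symmetric adj;
  adj_irrefl : irreflexive adj
}.

Definition isomorphic (V W : finType) (G : sgraph V) (H : sgraph W) : Prop :=
  exists2 f : V -> W, bijective f & forall u v, H (f u) (f v) = G u v.

Section Switching.
Variables (V : finType) (G : sgraph V) (U : {set V}).

Definition switch_rel : rel V :=
  fun u v => if (u \in U) != (v \in U) then ~~ G u v else G u v.

Lemma switch_sym : symmetric switch_rel.
Proof. by move=> u v; rewrite /switch_rel eq_sym adj_sym. Qed.

Lemma switch_irrefl : irreflexive switch_rel.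
Proof. by move=> u; rewrite /switch_rel eqxx adj_irrefl. Qed.

Definition switch : sgraph V := SGraph switch_sym switch_irrefl.
End Switching.

(* The graphs are compared through their adjacency relations, so that the
   proof fields of [sgraph] play no role. *)
Definition switching_equivalent (V : finType) (G H : sgraph V) : Prop :=
  exists U : {set V}, H =2 switch G U.

(* Rows and columns are numbered by the enumeration of the vertex type. *)
Definition adjacency_mx (V : finType) (G : sgraph V) : 'M[algC]_#|V| :=
  \matrix_(i, j) (G (enum_val i) (enum_val j))%:R.

Definition seidel_mx (V : finType) (G : sgraph V) : 'M[algC]_#|V| :=
  const_mx 1 - 1%:M - 2 *: adjacency_mx G.

(* Equality of spectra as multisets of eigenvalues.  As algC is algebraically
   closed, the multiplicities add up to the size of the matrix. *)
Definition same_spectrum (m n : nat) (A : 'M[algC]_m) (B : 'M[algC]_n) : Prop :=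
  forall a : algC, mup a (char_poly A) = mup a (char_poly B).

Definition S_determined (V : finType) (G : sgraph V) : Prop :=
  forall (W : finType) (H : sgraph W),
    same_spectrum (seidel_mx H) (seidel_mx G) ->
    exists2 G' : sgraph W, isomorphic G' G & switching_equivalent H G'.

Section CompleteMultipartite.
Variables (s : nat) (r n : 'I_s -> nat).

(* The vertex (i; (p, x)) is the x-th vertex of the p-th part of size n i. *)
Definition cmp_vertex : finType := {i : 'I_s & ('I_(r i) * 'I_(n i))%type}.

Definition cmp_part (u : cmp_vertex) : {i : 'I_s & 'I_(r i)} :=
  Tagged (fun i => 'I_(r i)) (tagged u).1.

Definition cmp_rel : rel cmp_vertex := fun u v => cmp_part u != cmp_part v.

Lemma cmp_sym : symmetric cmp_rel.
Proof. by move=> u v; rewrite /cmp_rel eq_sym. Qed.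

Lemma cmp_irrefl : irreflexive cmp_rel.
Proof. by move=> u; rewrite /cmp_rel eqxx. Qed.

Definition complete_multipartite : sgraph cmp_vertex :=
  SGraph cmp_sym cmp_irrefl.
End CompleteMultipartite.

(* Main.v *)
Require Import Defs.
From mathcomp Require Import all_boot all_order all_algebra all_field.
From mathcomp Require Import ring zify.

(* Write M = S + I, a matrix of signs with unit diagonal.

   For a complete multipartite graph M is positive semidefinite on the vectors
   of sum 0, so it has at most one negative eigenvalue.  Conversely a graph
   whose M has at most one negative eigenvalue is switching equivalent to a
   complete multipartite one: switch it so that a vertex v is isolated; were
   non-adjacency not transitive on the non-isolated vertices, v would lie in a
   set of five vertices inducing, up to switching, 2K_2 + K_1 or a pentagon, for
   which M has two negative eigenvalues.

   It remains to recover the sizes p_1, ..., p_k of the parts.  Up to a power of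
   X the characteristic polynomial of M is that of its quotient matrix,
     f = g + \sum_i p_i \prod_(j != i) (X - 2 p_j)
   where g = \prod_i (X - 2 p_i).  As 2 f = (2 - k) g + X g', f determines g up
   to a multiple of X^(k-2).  A size p occurring three times makes a = 2p a
   double root of f; but f / g has a negative derivative where it is defined, so
   the double roots of f are roots of g.  Hence any polynomial g with the same f
   vanishes at a, and the ambiguity disappears. *)

Set Implicit Arguments.
Unset Strict Implicit.
Unset Printing Implicit Defensive.
Import Order.TTheory GRing.Theory Num.Theory.

(** * Hermitian forms and the number of negative eigenvalues *)

Section Inertia.
Local Open Scope ring_scope.
Local Open Scope sesquilinear_scope.
Variable C : numClosedFieldType.

Definition qform n (M : 'M[C]_n) (u v : 'rV[C]_n) : C := (u *m M *m v ^t*) 0 0.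

(** A basis, orthogonal for the form, of a plane on which the form is negative definite. Both cross
    terms must vanish because [M] is not assumed hermitian. *)
Definition negative_pair n (M : 'M[C]_n) (u v : 'rV[C]_n) : bool :=
  [&& qform M u u < 0, qform M v v < 0, qform M u v == 0 & qform M v u == 0].

Lemma qform_pair n (M : 'M[C]_n) (u v : 'rV[C]_n) (a b : C) :
  qform M (a *: u + b *: v) (a *: u + b *: v) =
  `|a| ^+ 2 * qform M u u + a * b^* * qform M u v
  + (b * a^* * qform M v u + `|b| ^+ 2 * qform M v v).
Proof.
rewrite /qform.
have -> : (a *: u + b *: v)^t* = a^* *: u^t* + b^* *: v^t*.
  by apply/matrixP => i j; rewrite !mxE rmorphD !rmorphM.
by rewrite !mulmxDl !mulmxDr -!scalemxAl -!scalemxAr !scalerA !mxE !normCK.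
Qed.

(* [x] and [y] are the values at [u] and [v] of a linear form. *)
Lemma negative_pair_linform n (M : 'M[C]_n) (u v : 'rV[C]_n) (x y : C) :
  negative_pair M u v ->
  exists2 ab : C * C, ab.1 * x + ab.2 * y = 0
    & qform M (ab.1 *: u + ab.2 *: v) (ab.1 *: u + ab.2 *: v) < 0.
Proof.
case/and4P => u_lt0 v_lt0 /eqP uv0 /eqP vu0.
(* The pair [(y, - x)] might be zero if [y = 0]; in that case [v] itself lies in the kernel. *)
pose ab : C * C := if y == 0 then (0, 1) else (y, - x).
exists ab; first by rewrite /ab; case: eqP => [->|_] /=; ring.
rewrite qform_pair uv0 vu0 !mulr0 addr0 add0r /ab.
case: eqP => [_|/eqP y_neq0] /=.
  by rewrite normr0 normr1 expr0n expr1n mul0r add0r mul1r.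
rewrite ltr_wnDr //; last by rewrite pmulr_rlt0 // exprn_gt0 // normr_gt0.
by rewrite mulr_ge0_le0 ?exprn_ge0 // ltW.
Qed.

Lemma trmxC_mul m n p (A : 'M[C]_(m, n)) (B : 'M[C]_(n, p)) :
  (A *m B)^t* = B^t* *m A^t*.
Proof. by rewrite trmx_mul map_mxM. Qed.

Lemma spectral_qform n (M : 'M[C]_n) (u v : 'rV[C]_n) : M \is hermsymmx ->
  qform M u v = \sum_i spectral_diag M 0 i
    * (u *m (spectralmx M)^t*) 0 i * ((v *m (spectralmx M)^t*) 0 i)^*.
Proof.
move=> /hermitian_normalmx /orthomx_spectralP eM.
rewrite /qform {1}eM invmx_unitary ?spectral_unitarymx //.
set P := spectralmx M; set d := spectral_diag M; set y := u *m P^t*.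
have -> : u *m (P^t* *m diag_mx d *m P) *m v^t* =
    y *m diag_mx d *m (v *m P^t*)^t*.
  by rewrite trmxC_mul trmxCK !mulmxA.
rewrite mxE; apply: eq_bigr => i _; rewrite mul_mx_diag !mxE; ring.
Qed.

Lemma char_poly_similar n (P A B : 'M[C]_n) :
  P \in unitmx -> P *m A = B *m P -> char_poly A = char_poly B.
Proof.
move=> Pu eAB; rewrite /char_poly.
have Pp_neq0 : \det (map_mx polyC P) != 0.
  by rewrite det_map_mx polyC_eq0 -unitfE -unitmxE.
apply: (mulfI Pp_neq0); rewrite -det_mulmx mulrC -det_mulmx; congr (\det _).
by rewrite /char_poly_mx mulmxBr mulmxBl scalar_mxC -!map_mxM eAB.
Qed.

Lemma char_poly_spectral n (M : 'M[C]_n) : M \is hermsymmx ->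
  char_poly M = \prod_(a <- codom (spectral_diag M 0)) ('X - a%:P).
Proof.
move=> /hermitian_normalmx /orthomx_spectralP eM.
rewrite (@char_poly_similar _ (spectralmx M) _ (diag_mx (spectral_diag M))).
- rewrite char_poly_trig ?diag_mx_is_trig // codomE big_map enumT.
  by apply: eq_bigr => i _; rewrite mxE eqxx.
- exact: spectral_unit.
- by rewrite {2}eM !mulmxA mulmxV ?mul1mx // spectral_unit.
Qed.

Definition neg_index n (M : 'M[C]_n) : nat :=
  count (fun a => a < 0) (codom (spectral_diag M 0)).

(** The eigenvalues are the roots of the characteristic polynomial with multiplicity. Two sizes are
    allowed because the graphs to be compared live on different vertex types. *)
Lemma eq_neg_index m n (M : 'M[C]_m) (N : 'M[C]_n) :
  M \is hermsymmx -> N \is hermsymmx -> char_poly M = char_poly N ->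
  neg_index M = neg_index N.
Proof.
move=> hM hN; rewrite !char_poly_spectral // => /prod_XsubC_eq.
by move/permP; apply.
Qed.

Lemma neg_indexE n (M : 'M[C]_n) :
  neg_index M = #|[pred i | spectral_diag M 0 i < 0]|.
Proof. by rewrite /neg_index codomE count_map -sum1_count enumT sum1_card. Qed.

(** Two eigenvectors for negative eigenvalues form a negative pair. Conversely, with at most one
    negative eigenvalue the form is nonnegative on the kernel of some linear form, and every plane
    meets that kernel. *)
Lemma negative_pairP n (M : 'M[C]_n) : M \is hermsymmx ->
  (1 < neg_index M)%N <-> (exists u v, negative_pair M u v).
Proof.
move=> hM; rewrite neg_indexE; split=> [/card_gt1P|[u [v uvP]]].
  move=> [i [j [] /=]]; rewrite !inE => i_lt0 j_lt0 ij.
  have rowE k l : qform M (row k (spectralmx M)) (row l (spectralmx M)) =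
      (k == l)%:R * spectral_diag M 0 k.
    rewrite spectral_qform // -!row_mul.
    have /unitarymxP -> := spectral_unitarymx M.
    rewrite (bigD1 k) //= big1 ?addr0 => [|m mk].
      by rewrite !mxE eqxx mulr1 [l == k]eq_sym conjC_nat mulrC.
    by rewrite !mxE eq_sym (negPf mk) mulr0 mul0r.
  exists (row i (spectralmx M)), (row j (spectralmx M)).
  rewrite /negative_pair !rowE !eqxx [j == i]eq_sym (negPf ij).
  by rewrite !mul0r !mul1r i_lt0 j_lt0 eqxx.
rewrite ltnNge; apply/negP => le1.
pose N := [pred i | spectral_diag M 0 i < 0].
have [x [y xyP]] : exists x y : C, forall a b, a * x + b * y = 0 ->
    0 <= qform M (a *: u + b *: v) (a *: u + b *: v).
  (* The linear form is the coordinate along the eigenvector of the negative eigenvalue, or zero if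
     there is none. *)
  pose k0 := [pick i in N].
  pose f (w : 'rV[C]_n) := if k0 is Some i then (w *m (spectralmx M)^t*) 0 i else 0.
  exists (f u), (f v) => a b abP; rewrite spectral_qform //.
  apply: sumr_ge0 => i _.
  have dr : spectral_diag M 0 i \is Num.real.
    by have /mxOverP := hermitian_spectral_diag_real hM; apply.
  have [i_ge0|i_lt0] := real_leP (real0 C) dr.
    by rewrite -mulrA -normCK mulr_ge0 // exprn_ge0.
  suff -> : ((a *: u + b *: v) *m (spectralmx M)^t*) 0 i = 0.
    by rewrite mulr0 mul0r.
  move: abP; rewrite /f /k0.
  case: pickP => [j jN|/(_ i)]; last by rewrite !inE i_lt0.
  have -> : j = i by apply: (card_le1_eqP le1).
  by rewrite mulmxDl -!scalemxAl !mxE.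
have [[a b] /= ab0] := negative_pair_linform x y uvP.
by rewrite (le_gtF (xyP _ _ ab0)).
Qed.

End Inertia.

(** * Determinant identities for low-rank perturbations *)

Section Determinants.
Local Open Scope ring_scope.

(** Eliminating either off-diagonal product from the block matrix [N] computes its determinant in
    two ways, without any division. *)
Lemma det_sylvester (R : comNzRingType) m n (B : 'M[R]_(m, n)) (D : 'M_(n, m)) a :
  a ^+ n * \det (a%:M - B *m D) = a ^+ m * \det (a%:M - D *m B).
Proof.
pose N := block_mx a%:M B D 1%:M.
have e1 : N *m block_mx 1%:M 0 (- D) 1%:M = block_mx (a%:M - B *m D) B 0 1%:M.
  rewrite /N mulmx_block !mulmx1 !mulmx0 !mul1mx !add0r.
  by rewrite !mulmxN subrr.
have e2 : block_mx 1%:M 0 (- D) a%:M *m N = block_mx a%:M B 0 (a%:M - D *m B).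
  rewrite /N mulmx_block !mul1mx !mul0mx !addr0 !mulNmx mulmx1.
  by rewrite mul_mx_scalar mul_scalar_mx addNr [_ + a%:M]addrC.
move/(congr1 determinant): e1; move/(congr1 determinant): e2.
rewrite !det_mulmx det_ublock !det_lblock det_ublock !det1 !mul1r !mulr1.
by rewrite !det_scalar => + <-.
Qed.

(* [E] plays the role of the adjugate of [A]. *)
Lemma det_rank1_update (R : idomainType) n (A E : 'M[R]_n) d
    (u : 'cV_n) (v : 'rV_n) :
  E *m A = d%:M -> \det A = d -> d != 0 ->
  \det (A + u *m v) = d + (v *m E *m u) 0 0.
Proof.
move=> EA detA d_neq0; pose N := block_mx A u (- v) 1%:M.
have e1 : N *m block_mx 1%:M 0 v 1%:M = block_mx (A + u *m v) u 0 1%:M.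
  by rewrite /N mulmx_block !mulmx1 !mulmx0 !mul1mx !add0r addNr.
have e2 : block_mx 1%:M 0 (v *m E) d%:M *m N = block_mx A u 0 (v *m E *m u + d%:M).
  rewrite /N mulmx_block !mul1mx !mul0mx !addr0 -mulmxA EA mulmx1 mulmxN.
  by rewrite mul_mx_scalar mul_scalar_mx subrr.
move/(congr1 determinant): e1; move/(congr1 determinant): e2.
rewrite !det_mulmx det_ublock !det_lblock det_ublock !det1 !mul1r !mulr1.
rewrite det_scalar expr1 det_mx11 detA => + <- => /(mulfI d_neq0) ->.
by rewrite !mxE eqxx mulr1n addrC.
Qed.

Lemma det_diag_rank1 (R : idomainType) n (d : 'rV[R]_n) (u : 'cV_n) (v : 'rV_n) :
  (forall i, d 0 i != 0) ->
  \det (diag_mx d + u *m v) =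
  \prod_i d 0 i + \sum_i u i 0 * v 0 i * \prod_(j | j != i) d 0 j.
Proof.
move=> d_neq0; pose e := \row_i \prod_(j | j != i) d 0 j.
rewrite (@det_rank1_update _ _ _ (diag_mx e) (\prod_i d 0 i)) ?det_diag //.
- congr (_ + _); rewrite mxE; apply: eq_bigr => i _.
  by rewrite mul_mx_diag !mxE mulrC mulrA.
- apply/matrixP => i j; rewrite mul_diag_mx !mxE; case: eqP => [->|_].
    by rewrite !mulr1n [RHS](bigD1 j) // mulrC.
  by rewrite !mulr0n mulr0.
- by apply/prodf_neq0.
Qed.

End Determinants.

(** * Recovering the part sizes from the quotient polynomial *)

Section PartPolynomials.
Local Open Scope ring_scope.
Variable F : numFieldType.
Implicit Types (s t : seq nat) (a : F).

Definition part_poly s : {poly F} := \prod_(p <- s) ('X - (2 * p)%:R).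

(* The characteristic polynomial of the matrix with entries
   [(2 * (i == j) - 1) * p_j]; see [quotient_poly_sum] for a closed form. *)
Fixpoint quotient_poly s : {poly F} :=
  if s is p :: t
  then ('X - (2 * p)%:R) * quotient_poly t + p%:R * part_poly t else 1.

Lemma part_poly_cons p s : part_poly (p :: s) = ('X - (2 * p)%:R) * part_poly s.
Proof. by rewrite /part_poly big_cons. Qed.

Lemma deriv_natr n : (n%:R : {poly F})^`() = 0.
Proof. by rewrite -polyC_natr derivC. Qed.

Lemma deriv_part_poly_cons p s :
  (part_poly (p :: s))^`() = part_poly s + ('X - (2 * p)%:R) * (part_poly s)^`().
Proof. by rewrite part_poly_cons derivM derivB derivX deriv_natr subr0 mul1r. Qed.

Lemma deriv_quotient_poly_cons p s :
  (quotient_poly (p :: s))^`() = quotient_poly s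
    + ('X - (2 * p)%:R) * (quotient_poly s)^`() + p%:R * (part_poly s)^`().
Proof.
by rewrite /= derivD !derivM derivB derivX !deriv_natr subr0 mul1r mul0r add0r.
Qed.

(** Writing X = (X - 2 p_i) + 2 p_i in each term of X g' gives X g' = k g + 2 (f - g). *)
Lemma quotient_polyE s :
  2%:R * quotient_poly s =
  (2%:R - (size s)%:R) * part_poly s + 'X * (part_poly s)^`().
Proof.
elim: s => [|p s IHs].
  by rewrite /part_poly big_nil (deriv_natr 1) /=; ring.
have -> : 2%:R * quotient_poly (p :: s) =
    ('X - (2 * p)%:R) * (2%:R * quotient_poly s) + (2 * p)%:R * part_poly s.
  by rewrite /=; ring.
by rewrite IHs deriv_part_poly_cons part_poly_cons /=; ring.
Qed.

Lemma part_poly_root s p : root (part_poly s) (2 * p)%:R = (p \in s).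
Proof.
elim: s => [|q s IHs]; first by rewrite /part_poly big_nil rootC oner_eq0.
rewrite part_poly_cons rootM IHs in_cons -polyC_natr root_XsubC eqr_nat.
by rewrite eqn_mul2l.
Qed.

(* [f'g - fg'] is [g^2] times the derivative [- \sum p / (X - 2p)^2] of [f/g]. *)
Lemma wronskian_lt0 s a : a \is Num.real -> all (leq 1) s -> s != [::] ->
  (part_poly s).[a] != 0 ->
  ((quotient_poly s)^`() * part_poly s
   - quotient_poly s * (part_poly s)^`()).[a] < 0.
Proof.
move=> a_real; elim: s => [//|p s IHs]; rewrite [all _ _]/= => /andP[p_gt0 s_gt0] _.
rewrite part_poly_cons hornerM mulf_eq0 negb_or => /andP[ap gs].
have -> : (quotient_poly (p :: s))^`() * (('X - (2 * p)%:R) * part_poly s)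
   - quotient_poly (p :: s) * (('X - (2 * p)%:R) * part_poly s)^`() =
   ('X - (2 * p)%:R) ^+ 2 * ((quotient_poly s)^`() * part_poly s
   - quotient_poly s * (part_poly s)^`()) - p%:R * part_poly s ^+ 2.
  by rewrite -part_poly_cons deriv_quotient_poly_cons deriv_part_poly_cons
    part_poly_cons /=; ring.
have real_g : (part_poly s).[a] \is Num.real.
  rewrite /part_poly horner_prod rpred_prod // => q _.
  by rewrite -polyC_natr hornerXsubC rpredB // realn.
have real_ap : ('X - (2 * p)%:R).[a] \is Num.real.
  by rewrite -polyC_natr hornerXsubC rpredB // realn.
rewrite hornerD hornerN hornerM horner_exp [(p%:R * _).[a]]hornerM horner_exp.
(* Strictness comes from the term of [p], since the contribution of the tail is zero when the tail
   is empty. *)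
have lt0 : - ((p%:R : {poly F}).[a] * (part_poly s).[a] ^+ 2) < 0.
  rewrite oppr_lt0 -polyC_natr hornerC mulr_gt0 ?ltr0n //.
  by rewrite lt0r expf_neq0 //= real_exprn_even_ge0.
rewrite ltr_wnDl // mulr_ge0_le0 ?real_exprn_even_ge0 //.
have [->|s_neq0] := eqVneq s [::]; last exact/ltW/IHs.
by rewrite /part_poly big_nil mulr1 mul1r subrr horner0.
Qed.

Lemma part_poly_dvd s p : ('X - (2 * p)%:R) ^+ count_mem p s %| part_poly s.
Proof.
elim: s => [|q s IHs]; first by rewrite dvd1p.
rewrite part_poly_cons /=; have [->|_] /= := eqVneq q p.
  by rewrite add1n exprS dvdp_mul2l // -polyC_natr polyXsubC_eq0.
by rewrite add0n dvdp_mull.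
Qed.

Lemma perm_part_poly s t : part_poly s = part_poly t -> perm_eq s t.
Proof.
rewrite /part_poly; under eq_bigr do rewrite -polyC_natr.
under [RHS]eq_bigr do rewrite -polyC_natr.
rewrite -(big_map (fun p => (2 * p)%:R : F) xpredT (fun x => 'X - x%:P)).
rewrite -(big_map (fun p => (2 * p)%:R : F) xpredT (fun x => 'X - x%:P)).
move/prod_XsubC_eq; apply: perm_map_inj => p q /eqP.
by rewrite eqr_nat eqn_mul2l => /eqP.
Qed.

(** At 0 the relation [quotient_polyE] reads 2 f(0) = (2 - k) g(0), and 0 is not a root of g because
    all sizes are positive. This makes the power of X in the characteristic polynomial reveal the
    number of parts. *)
Lemma quotient_poly_at0 s : all (leq 1) s -> size s != 2%N ->
  (quotient_poly s).[0] != 0.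
Proof.
move=> s_gt0 s_neq2.
have /(congr1 (horner^~ 0)) := quotient_polyE s.
rewrite /= hornerD !hornerM hornerX mul0r addr0 -!polyC_natr -polyCB !hornerC.
move=> e; apply/eqP => q0; move/eqP: e; rewrite q0 mulr0 eq_sym mulf_eq0.
rewrite subr_eq0 eqr_nat eq_sym (negPf s_neq2) /=; apply/negP.
have := part_poly_root s 0; rewrite muln0 /root => ->.
by apply/negP => /(allP s_gt0).
Qed.

(* [2 f = (2 - k) g + X g'] determines [g] from [f] up to a multiple of
   ['X^(k-2)], and a common positive root removes this ambiguity. *)
Lemma quotient_poly_inj s t p : all (leq 1) s -> all (leq 1) t ->
  size s = size t -> (2 < count_mem p s)%N ->
  quotient_poly s = quotient_poly t -> perm_eq s t.
Proof.
move=> s_gt0 t_gt0 est p3 ef; apply: perm_part_poly.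
have ps : p \in s by rewrite -has_pred1 has_count; apply: leq_trans p3.
have p_gt0 : (0 < p)%N by apply: (allP s_gt0).
pose a : F := (2 * p)%:R.
have a_neq0 : a != 0 by rewrite pnatr_eq0; lia.
have gsa : (part_poly s).[a] = 0 by apply/eqP; rewrite -/(root _ _) part_poly_root.
have aE : 'X - (2 * p)%:R = 'X - a%:P by rewrite polyC_natr.
have [q gsE] : exists q, part_poly s = q * ('X - a%:P) ^+ 3.
  by apply/dvdpP; apply: dvdp_trans (part_poly_dvd s p); rewrite aE dvdp_exp2l.
have [u fE] : exists u, 2%:R * quotient_poly s = u * ('X - a%:P) ^+ 2.
  (* Substitute g = q (X - a)^3 into [quotient_polyE]; differentiation costs one factor X - a. *)
  exists ((2%:R - (size s)%:R) * q * ('X - a%:P) + 'X * (q^`() * ('X - a%:P)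
    + 3%:R * q)).
  by rewrite quotient_polyE gsE derivM deriv_exp derivXsubC mul1r /=; ring.
have ev0 (v w : {poly F}) : 2%:R * v = w * ('X - a%:P) -> v.[a] = 0.
  move=> /(congr1 (horner^~ a)) /=; rewrite !hornerM hornerXsubC subrr mulr0.
  by rewrite -polyC_natr hornerC => /eqP; rewrite mulf_eq0 pnatr_eq0 => /eqP.
have fa : (quotient_poly s).[a] = 0.
  by apply: (ev0 _ (u * ('X - a%:P))); rewrite fE; ring.
have f'a : (quotient_poly s)^`().[a] = 0.
  apply: (ev0 _ (u^`() * ('X - a%:P) + 2%:R * u)).
  have /(congr1 (@deriv F)) := fE.
  rewrite derivM deriv_natr mul0r add0r derivM deriv_exp derivXsubC mul1r => ->.
  by ring.
(* Since [t] has the same f, with a double root at [a], f'g - fg' vanishes at [a] for [t] too, which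
   [wronskian_lt0] forbids unless g does. *)
have gta : (part_poly t).[a] = 0.
  apply/eqP; apply: contraT => gta_neq0.
  have t_neq0 : t != [::] by rewrite -size_eq0 -est; case: (s) ps.
  have := wronskian_lt0 (realn _ _) t_gt0 t_neq0 gta_neq0.
  by rewrite -ef hornerD hornerN !hornerM f'a fa !mul0r subrr ltxx.
pose h := part_poly s - part_poly t.
have hE : (2%:R - (size s)%:R) * h + 'X * h^`() = 0.
  apply: (@addIr _ (2%:R * quotient_poly t)); rewrite add0r.
  by rewrite -{2}ef !quotient_polyE -est /h derivB; ring.
have size_s : (2 < size s)%N by apply: leq_trans p3 (count_size _ _).
(* The equation [hE] multiplies the coefficient of X^j by 2 - k + j. *)
have hj j : j != (size s - 2)%N -> h`_j = 0.
  move=> jk; have /(congr1 (fun r : {poly F} => r`_j)) := hE.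
  rewrite coefD -!polyC_natr -polyCB coefCM coefXM coef0 coef_deriv.
  have -> : (if j == 0%N then 0 else h`_j.-1.+1 *+ j.-1.+1) = j%:R * h`_j.
    by case: j {jk} => [|j]; rewrite ?mul0r // mulr_natl.
  rewrite -mulrDl => /eqP; rewrite mulf_eq0 => /orP[|/eqP //].
  rewrite addrAC subr_eq0 -natrD eqr_nat => /eqP; lia.
have hX : h = h`_(size s - 2)%N *: 'X^(size s - 2)%N.
  apply/polyP => j; rewrite coefZ coefXn.
  by have [->|/hj ->] := eqVneq j (size s - 2)%N; rewrite ?mulr1 ?mulr0.
have : h.[a] = 0 by rewrite /h hornerD hornerN gsa gta subrr.
rewrite hX hornerZ hornerXn => /eqP; rewrite mulf_eq0 expf_eq0 (negPf a_neq0).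
rewrite andbF orbF => /eqP h0; apply/eqP; rewrite -subr_eq0 -/h hX h0.
by rewrite scale0r.
Qed.

(** If the lengths differed, the longer list would have more than two elements and a quotient
    polynomial vanishing at 0, against [quotient_poly_at0]. *)
Lemma part_sizes_unique s t p : all (leq 1) s -> all (leq 1) t ->
  (2 < count_mem p s)%N ->
  'X^(size t) * quotient_poly s = 'X^(size s) * quotient_poly t -> perm_eq s t.
Proof.
move=> s_gt0 t_gt0 p3 e.
have size_s : (2 < size s)%N by apply: leq_trans p3 (count_size _ _).
have X_neq0 n : 'X^n != 0 :> {poly F} by rewrite -size_poly_eq0 size_polyXn.
have at0 n (r : {poly F}) : (0 < n)%N -> ('X^n * r).[0] = 0.
  by case: n => // n _; rewrite hornerM hornerXn expr0n mul0r.
have [lt_st|lt_ts|est] := ltngtP (size s) (size t).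
- have : quotient_poly t = 'X^(size t - size s) * quotient_poly s.
    apply: (mulfI (X_neq0 (size s))).
    by rewrite -e mulrA -exprD subnKC // ltnW.
  move=> /(congr1 (horner^~ 0)) /=; rewrite at0 ?subn_gt0 // => /eqP.
  by rewrite (negPf (quotient_poly_at0 _ _)) //; lia.
- have : quotient_poly s = 'X^(size s - size t) * quotient_poly t.
    apply: (mulfI (X_neq0 (size t))).
    by rewrite e mulrA -exprD subnKC // ltnW.
  move=> /(congr1 (horner^~ 0)) /=; rewrite at0 ?subn_gt0 // => /eqP.
  by rewrite (negPf (quotient_poly_at0 _ _)) //; lia.
- apply: (@quotient_poly_inj s t p) => //.
  by apply: (mulfI (X_neq0 (size t))); rewrite e est.
Qed.
End PartPolynomials.

(** * The characteristic polynomial of a complete multipartite graph *)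

Section QuotientMatrix.
Local Open Scope ring_scope.
Variable F : numFieldType.

Lemma quotient_poly_sum (I : eqType) (r : seq I) (f : I -> nat) : uniq r ->
  quotient_poly F [seq f i | i <- r] =
    \prod_(i <- r) ('X - (2 * f i)%:R)
    + \sum_(i <- r) (f i)%:R * \prod_(j <- r | j != i) ('X - (2 * f j)%:R).
Proof.
elim: r => [_|x r IHr /= /andP[xr r_uniq]]; first by rewrite /= !big_nil addr0.
rewrite IHr // /part_poly big_map !big_cons eqxx /=.
have -> : \prod_(j <- r | j != x) ('X - (2 * f j)%:R) =
    \prod_(j <- r) ('X - (2 * f j)%:R) :> {poly F}.
  rewrite big_seq_cond [RHS]big_seq; apply: eq_bigl => j.
  by case: (boolP (j \in r)) => //= jr; apply: contraNneq xr => <-.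
rewrite mulrDr -addrA; congr (_ + _); rewrite addrC; congr (_ + _).
rewrite big_distrr /= big_seq [RHS]big_seq; apply: eq_bigr => i ir.
rewrite big_cons; have -> : x != i by apply: contraNneq xr => ->.
by rewrite mulrCA.
Qed.

(** This is J - 2A for the complete multipartite graph whose parts are the fibres of [c]. *)
Definition part_mx (V I : finType) (c : V -> I) : 'M[F]_#|V| :=
  \matrix_(i, j) ((c (enum_val i) == c (enum_val j))%:R *+ 2 - 1).

Definition part_sizes (V I : finType) (c : V -> I) : seq nat :=
  [seq #|[pred v | c v == a]| | a : I].

(** The matrix factors as B K B^T with B the incidence matrix of vertices and parts and K = 2I - J.
    Sylvester's identity reduces it to K B^T B, where B^T B is the diagonal matrix of the part
    sizes, so that X - K B^T B is diagonal plus rank one. *)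
Lemma char_poly_part_mx (V I : finType) (c : V -> I) :
  'X^#|I| * char_poly (part_mx c) = 'X^#|V| * quotient_poly F (part_sizes c).
Proof.
pose B : 'M[F]_(#|V|, #|I|) := \matrix_(i, a) (c (enum_val i) == enum_val a)%:R.
pose K : 'M[F]_#|I| := 2%:M - const_mx 1.
pose p a : nat := #|[pred v | c v == enum_val (a : 'I_#|I|)]|.
have BB : B^T *m B = diag_mx (\row_a (p a)%:R).
  apply/matrixP => a b; rewrite !mxE.
  under eq_bigr do rewrite !mxE -natrM mulnb.
  rewrite -(big_enum_val (fun v => ((c v == enum_val a) && (c v == enum_val b))%:R)).
  rewrite -natr_sum; have [<-|ab] := eqVneq a b.
    rewrite mulr1n /p -sum1_card [in RHS]big_mkcond; congr (_%:R).
    apply: eq_bigr => v _.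
    by rewrite andbb inE; case: eqP.
  rewrite mulr0n big1 // => v _; case: eqP => //= ->.
  by rewrite (inj_eq enum_val_inj) (negPf ab).
have eM : part_mx c = B *m (K *m B^T).
  have -> : K *m B^T = 2 *: B^T - const_mx 1.
    rewrite mulmxBl mul_scalar_mx; congr (_ - _).
    apply/matrixP => a i; rewrite !mxE; under eq_bigr do rewrite !mxE mul1r.
    rewrite -(big_enum_val (fun x => (c (enum_val i) == x)%:R)).
    rewrite (bigD1 (c (enum_val i))) //= eqxx big1 ?addr0 // => x /negPf.
    by rewrite eq_sym => ->.
  apply/matrixP => i j; rewrite !mxE.
  rewrite (bigD1 (enum_rank (c (enum_val i)))) //= big1 ?addr0 => [|a].
    by rewrite !mxE enum_rankK eqxx mul1r mulr_natl [c (enum_val j) == _]eq_sym.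
  rewrite -(inj_eq enum_val_inj) enum_rankK => /negPf ca.
  by rewrite !mxE eq_sym ca mul0r.
rewrite /char_poly /char_poly_mx eM map_mxM det_sylvester; congr (_ * _).
rewrite -map_mxM -mulmxA BB.
have -> : 'X%:M - map_mx polyC (K *m diag_mx (\row_a (p a)%:R)) =
  diag_mx (\row_a ('X - (2 * p a)%:R)) + const_mx 1 *m (\row_a (p a)%:R).
  apply/matrixP => a b; rewrite mul_mx_diag !mxE big_ord1 !mxE.
  rewrite polyCM polyCB polyCMn polyC_natr.
  by case: eqP => [->|_]; rewrite ?mulr1n ?mulr0n; ring.
rewrite det_diag_rank1 => [|a]; last by rewrite mxE -polyC_natr polyXsubC_eq0.
rewrite /part_sizes /image_mem quotient_poly_sum ?enum_uniq //.
rewrite !big_enum /= [X in _ = X + _]big_enum_val [X in _ = _ + X]big_enum_val.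
congr (_ + _).
  by apply: eq_bigr => a _; rewrite mxE.
apply: eq_bigr => a _; rewrite big_enum_cond big_enum_val_cond !mxE mul1r.
congr (_ * _); apply: eq_big => b; first by rewrite (inj_eq enum_val_inj).
by rewrite mxE.
Qed.
End QuotientMatrix.

(** * The signed matrix of a graph and its negative eigenvalues *)

Section Seidel.
Local Open Scope ring_scope.
Local Open Scope sesquilinear_scope.

Lemma char_poly_shift (R : comNzRingType) n (A : 'M[R]_n) (a : R) :
  char_poly (A + a%:M) = char_poly A \Po ('X - a%:P).
Proof.
rewrite /char_poly -(det_map_mx (comp_poly ('X - a%:P))); congr (\det _).
apply/matrixP => i j; rewrite !mxE !rmorphB /= rmorphMn /= comp_polyX comp_polyC.
by rewrite polyCD polyCMn mulrnBl; ring.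
Qed.

Lemma mup_prod_XsubC (F : fieldType) (s : seq F) a :
  mup a (\prod_(b <- s) ('X - b%:P)) = count_mem a s.
Proof.
elim: s => [|b s IHs]; first by rewrite big_nil mupNroot // rootC oner_eq0.
rewrite big_cons mupM ?polyXsubC_eq0 ?monic_neq0 ?monic_prod_XsubC // IHs /=.
by rewrite -['X - b%:P]expr1 mup_XsubCX; case: eqVneq.
Qed.

(** Characteristic polynomials are monic and split over [algC], so the root multiplicities determine
    them. *)
Lemma same_spectrum_char_poly m n (A : 'M[algC]_m) (B : 'M[algC]_n) :
  same_spectrum A B -> char_poly A = char_poly B.
Proof.
rewrite /same_spectrum => eAB.
have [s eA] := closed_field_poly_normal (char_poly A).
have [t eB] := closed_field_poly_normal (char_poly B).
move: eA eB eAB; rewrite !(monicP (char_poly_monic _)) !scale1r => -> -> eAB.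
by apply/perm_big/allP => a _; rewrite /= -!mup_prod_XsubC eAB.
Qed.

Definition signed_mx (V : finType) (G : sgraph V) : 'M[algC]_#|V| :=
  seidel_mx G + 1%:M.

(** Integer values let the forms in [forbidden_quintuple] be evaluated by computation. *)
Definition edge_sign (V : finType) (G : sgraph V) (u v : V) : int :=
  if G u v then -1 else 1.

Lemma signed_mxE (V : finType) (G : sgraph V) i j :
  signed_mx G i j = (edge_sign G (enum_val i) (enum_val j))%:~R.
Proof.
rewrite !mxE addrAC subrK /edge_sign.
by case: (G _ _); rewrite ?mulr1 ?mulr0 ?subr0 //= mulrNz; ring.
Qed.

Lemma edge_signC (V : finType) (G : sgraph V) u v :
  edge_sign G u v = edge_sign G v u.
Proof. by rewrite /edge_sign adj_sym. Qed.

Lemma signed_mx_herm (V : finType) (G : sgraph V) : signed_mx G \is hermsymmx.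
Proof.
apply: realsym_hermsym.
  apply/is_hermitianmxP; rewrite expr0 scale1r.
  by apply/matrixP => i j; rewrite signed_mxE edge_signC -signed_mxE !mxE.
by apply/mxOverP => i j; rewrite signed_mxE Rreal_int.
Qed.

Lemma signed_mx_multipartite (V I : finType) (G : sgraph V) (c : V -> I) :
  (forall u v, G u v = (c u != c v)) -> signed_mx G = part_mx algC c.
Proof.
move=> Gc; apply/matrixP => i j; rewrite signed_mxE mxE /edge_sign Gc.
by case: eqP => _ /=; [rewrite mulr2n addrK | rewrite mul0rn sub0r mulrNz].
Qed.

(** Switching conjugates the signed matrix by the diagonal matrix with entries -1 on [U] and 1
    elsewhere. *)
Lemma char_poly_switch (V : finType) (G : sgraph V) (U : {set V}) :
  char_poly (signed_mx (switch G U)) = char_poly (signed_mx G).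
Proof.
pose e (v : V) : algC := (-1) ^+ (v \in U).
pose P : 'M[algC]_#|V| := diag_mx (\row_i e (enum_val i)).
apply: (@char_poly_similar _ _ P).
  rewrite unitmxE det_diag unitfE; apply/prodf_neq0 => i _.
  by rewrite mxE signr_eq0.
rewrite /P mul_diag_mx mul_mx_diag; apply/matrixP => i j; rewrite [LHS]mxE [RHS]mxE.
rewrite !signed_mxE !mxE /edge_sign /= /switch_rel /e.
by case: (_ \in U); case: (_ \in U); case: (G _ _);
  rewrite /= ?expr0 ?expr1 ?mulrNz ?mulr1 ?mul1r ?mulrN1 ?mulN1r ?opprK.
Qed.

(** A negative definite plane would contain a negative vector of sum 0, but on such vectors 2 B B^*
    - J acts as twice a Gram matrix. *)
Lemma neg_index_multipartite (V I : finType) (G : sgraph V) (c : V -> I) :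
  (forall u v, G u v = (c u != c v)) -> (neg_index (signed_mx G) <= 1)%N.
Proof.
move=> Gc; rewrite leqNgt; apply/negP.
move=> /(proj1 (negative_pairP (signed_mx_herm G))) [u [v uvP]].
have [[a b] /= ab0] := negative_pair_linform
  ((u *m const_mx 1) 0 (0 : 'I_1)) ((v *m const_mx 1) 0 (0 : 'I_1)) uvP.
set w := a *: u + b *: v; rewrite le_gtF // (signed_mx_multipartite Gc).
have w0 : w *m const_mx 1 = 0 :> 'M_1.
  by apply/matrixP => i j; rewrite !ord1 mulmxDl -!scalemxAl !mxE in ab0 *.
pose B : 'M[algC]_(#|V|, #|I|) := \matrix_(i, a) (c (enum_val i) == enum_val a)%:R.
have -> : part_mx algC c = 2 *: (B *m B^t*) - const_mx 1 *m (const_mx 1 : 'rV_#|V|).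
  apply/matrixP => i j; rewrite !mxE big_ord1 !mxE mulr1; congr (_ - _).
  rewrite (bigD1 (enum_rank (c (enum_val i)))) //= big1 ?addr0 => [|k].
    rewrite !mxE enum_rankK eqxx mul1r conjC_nat mulr_natl.
    by rewrite [c (enum_val j) == _]eq_sym.
  rewrite -(inj_eq enum_val_inj) enum_rankK => /negPf ca.
  by rewrite !mxE eq_sym ca mul0r.
rewrite /qform mulmxBr mulmxA w0 mul0mx subr0 -scalemxAr -scalemxAl mulmxA.
rewrite -[w *m B *m B^t* *m _]mulmxA -(trmxC_mul w B) !mxE mulr_ge0 //.
rewrite sumr_ge0 // => k _.
by rewrite !mxE -normCK exprn_ge0.
Qed.

Definition vertex_comb (V : finType) (l : seq (int * V)) : 'rV[algC]_#|V| :=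
  \sum_(k <- l) k.1%:~R *: delta_mx 0 (enum_rank k.2).

Lemma qform_vertex_comb (V : finType) (G : sgraph V) (l l' : seq (int * V)) :
  qform (signed_mx G) (vertex_comb l) (vertex_comb l') =
  (\sum_(k <- l) \sum_(k' <- l') k.1 * k'.1 * edge_sign G k.2 k'.2)%:~R.
Proof.
pose d (x : V) : 'rV[algC]_#|V| := delta_mx 0 (enum_rank x).
have dE x y : (d x *m signed_mx G *m (d y)^t*) 0 0 = (edge_sign G x y)%:~R.
  rewrite /d -rowE mxE (bigD1 (enum_rank y)) //= big1 ?addr0 => [|k /negPf ky].
    by rewrite [row _ _ _ _]mxE signed_mxE !enum_rankK !mxE !eqxx conjC1 mulr1.
  by rewrite !mxE ky andbF conjC0 mulr0.
rewrite /qform /vertex_comb !mulmx_suml summxE rmorph_sum; apply: eq_bigr => k _.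
have -> : (\sum_(k <- l') k.1%:~R *: d k.2)^t* =
    \sum_(k <- l') k.1%:~R *: (d k.2)^t*.
  apply/matrixP => i j; rewrite !(mxE, summxE) rmorph_sum; apply: eq_bigr => m _.
  by rewrite !mxE rmorphM /= conj_Creal // Rreal_int.
rewrite mulmx_sumr summxE rmorph_sum; apply: eq_bigr => k' _.
by rewrite -!scalemxAl -scalemxAr scalerA mxE dE !rmorphM.
Qed.

(* Up to switching, these are the two two-graphs on five vertices, the pentagon
   and [2K_2 + K_1], whose signed matrix has two negative eigenvalues. *)
Lemma forbidden_quintuple (V : finType) (G : sgraph V) (v x y z w : V) :
  (forall t, ~~ G v t) -> ~~ G x y -> ~~ G y z -> G x z -> G y w ->
  (1 < neg_index (signed_mx G))%N.
Proof.
move=> vG0 /negPf xy /negPf yz xz yw.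
have vG t : G v t = false by apply/negbTE.
have Gv t : G t v = false by rewrite adj_sym.
have [yx zy zx wy] : [/\ G y x = false, G z y = false, G z x & G w y].
  by rewrite (adj_sym G y) (adj_sym G z) (adj_sym G z) (adj_sym G w).
apply/(negative_pairP (signed_mx_herm G)).
suff [l [l']] : exists l l' : seq (int * V),
    [&& \sum_(k <- l) \sum_(k' <- l) k.1 * k'.1 * edge_sign G k.2 k'.2 < 0,
        \sum_(k <- l') \sum_(k' <- l') k.1 * k'.1 * edge_sign G k.2 k'.2 < 0,
        \sum_(k <- l) \sum_(k' <- l') k.1 * k'.1 * edge_sign G k.2 k'.2 == 0 &
        \sum_(k <- l') \sum_(k' <- l) k.1 * k'.1 * edge_sign G k.2 k'.2 == 0].
  exists (vertex_comb l), (vertex_comb l').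
  by rewrite /negative_pair !qform_vertex_comb !ltrz0 !intr_eq0.
(* If [w] is adjacent to both or neither of [x] and [z], the class is that of 2K_2 + K_1 and the
   first vector is an eigenvector for -2. Otherwise there is an induced path on four vertices
   besides [v], which switches to the pentagon. *)
case wx: (G w x) (adj_sym G x w) => xw; case wz: (G w z) (adj_sym G z w) => zw.
- exists [:: (1, x); (1, z); (-1, v); (1, w)],
    [:: (1, x); (1, z); (1, v); (-1, w); (-2, y)].
  by rewrite !big_cons !big_nil /= /edge_sign !(vG, Gv, xy, yz, xz, yw, yx, zy,
    zx, wy, wx, wz, xw, zw, adj_irrefl).
- exists [:: (1, v); (-1, w); (-1, x)],
    [:: (-1, z); (1, w); (-1, x); (1, y)].
  by rewrite !big_cons !big_nil /= /edge_sign !(vG, Gv, xy, yz, xz, yw, yx, zy,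
    zx, wy, wx, wz, xw, zw, adj_irrefl).
- exists [:: (1, v); (-1, w); (-1, z)],
    [:: (-1, x); (1, w); (-1, z); (1, y)].
  by rewrite !big_cons !big_nil /= /edge_sign !(vG, Gv, xy, yz, xz, yw, yx, zy,
    zx, wy, wx, wz, xw, zw, adj_irrefl).
- exists [:: (1, x); (1, z); (-1, y); (-1, w)],
    [:: (1, x); (1, z); (1, y); (1, w); (-2, v)].
  by rewrite !big_cons !big_nil /= /edge_sign !(vG, Gv, xy, yz, xz, yw, yx, zy,
    zx, wy, wx, wz, xw, zw, adj_irrefl).
Qed.
End Seidel.

(** * Switching to a complete multipartite graph *)

Lemma neg_index_switch (V : finType) (G : sgraph V) (U : {set V}) :
  neg_index (signed_mx (switch G U)) = neg_index (signed_mx G).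
Proof.
by apply: eq_neg_index; rewrite ?signed_mx_herm // char_poly_switch.
Qed.

Lemma switch_switch (V : finType) (G : sgraph V) (U Z : {set V}) :
  switch (switch G U) Z =2 switch G [set x | (x \in U) != (x \in Z)].
Proof.
move=> u v; rewrite /= /switch_rel /= /switch_rel !inE.
by do 4!case: (_ \in _); case: (G u v).
Qed.

(* After switching so that some vertex is isolated, switching the set [Z] of all
   isolated vertices makes non-adjacency transitive. *)
Lemma switch_multipartite (V : finType) (G : sgraph V) :
  neg_index (signed_mx G) <= 1 ->
  exists (U : {set V}) (c : V -> {set V}),
    forall u v, switch G U u v = (c u != c v).
Proof.
move=> le1; have [v _|V0] := pickP (@predT V); last first.
  by exists set0, (fun=> set0) => u; have := V0 u.
pose H := switch G [set t | G v t].
have vH t : ~~ H v t.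
  by rewrite /H /= /switch_rel !inE adj_irrefl; case: (G v t).
pose Z := [set x | [forall t, ~~ H x t]].
have ZP x y : x \in Z -> H x y = false.
  by rewrite inE => /forallP/(_ y)/negbTE.
(* Isolated vertices are non-adjacent to everything, which would spoil transitivity; in [K] they
   form a single part joined to all the rest. *)
pose K := switch H Z.
have nadjZ x y : ~~ K x y -> (x \in Z) = (y \in Z).
  rewrite /K /= /switch_rel; case: ifP => [|/negbFE/eqP //].
  rewrite negbK; case: (boolP (x \in Z)) => [xZ|_]; first by rewrite (ZP x y).
  by case: (boolP (y \in Z)) => // yZ; rewrite (adj_sym H) (ZP y x).
have nadj_trans x y z : ~~ K x y -> ~~ K y z -> ~~ K x z.
  move=> xy yz; have exy := nadjZ _ _ xy; have eyz := nadjZ _ _ yz.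
  have KE s t : (s \in Z) = (t \in Z) -> K s t = H s t.
    by move=> e; rewrite /K /= /switch_rel e eqxx.
  move: xy yz; rewrite !KE ?exy // => xy yz; have [yZ|yZ] := boolP (y \in Z).
    by rewrite ZP // exy.
  (* Outside [Z] the vertex [y] has a neighbour [w], which completes the forbidden configuration. *)
  apply: contraT; rewrite negbK => xz.
  move: yZ; rewrite inE negb_forall => /existsP[w]; rewrite negbK => yw.
  have := forbidden_quintuple vH xy yz xz yw.
  by rewrite neg_index_switch ltnNge le1.
exists [set x | (x \in [set t | G v t]) != (x \in Z)].
(* The part of a vertex is its class under non-adjacency. *)
exists (fun x => [set y | ~~ K x y]).
move=> x y; rewrite -switch_switch -/H -/K.
have [xy|xy] := boolP (K x y); apply/esym.
  apply/eqP => /setP/(_ y); rewrite !inE xy.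
  by rewrite (_ : K y y = false) // adj_irrefl.
apply/negbF/eqP/setP => t; rewrite !inE; apply/idP/idP; last exact: nadj_trans.
by apply: nadj_trans; rewrite adj_sym.
Qed.

(** * Bijections between vertex sets with matching parts *)

Lemma perm_map_lift (S T : eqType) (U : eqType) (f : S -> U) (g : T -> U) s t :
  perm_eq (map f s) (map g t) ->
  exists2 t', perm_eq t' t & map g t' = map f s.
Proof.
elim: s t => [|x s IHs] t /= e.
  exists [::] => //; move/perm_size: e; rewrite size_map.
  by case: t.
have /mapP[y yt fx] : f x \in map g t by rewrite -(perm_mem e) mem_head.
have ty := perm_to_rem yt.
have [|t' tt' et'] := IHs (rem y t).
  rewrite -(perm_cons (f x)); apply: (perm_trans e); rewrite fx -map_cons.
  exact: perm_map.
exists (y :: t'); last by rewrite /= et' fx.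
by rewrite perm_sym (perm_trans ty) // perm_cons perm_sym.
Qed.

(** Reorder the enumeration of [W] so that [g] takes on it the successive values of [f] on the
    enumeration of [V], then match positions. *)
Lemma fiber_bijection (V W : finType) (T : eqType) (f : V -> T) (g : W -> T) :
  perm_eq (codom f) (codom g) ->
  exists2 h : V -> W, bijective h & forall v, g (h v) = f v.
Proof.
rewrite !codomE => e; have [t tW gt] := perm_map_lift e.
have size_t : size t = #|V| by rewrite -(size_map g) gt size_map cardE.
have VW : #|V| = #|W| by rewrite -size_t (perm_size tW) cardE.
(* The vertex [w0] serves as the default of [nth]; if there is none, both types are empty. *)
have [w0 _|W0] := pickP (@predT W); last first.
  have V0 (v : V) : False by apply: (fintype0 v); rewrite VW (eq_card0 W0).
  exists (fun v => False_rect W (V0 v)) => [|v]; last by case: (V0 v).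
  by apply: inj_card_bij => [v|]; [case: (V0 v) | rewrite VW].
have enumV v : v \in enum V by rewrite mem_enum.
have ltV v : index v (enum V) < size t by rewrite size_t cardE index_mem.
exists (fun v => nth w0 t (index v (enum V))) => [|v].
  apply: inj_card_bij; last by rewrite VW.
  move=> u v /eqP; rewrite nth_uniq ?ltV ?(perm_uniq tW) ?enum_uniq //.
  by move/eqP => uv; rewrite -(nth_index u (enumV u)) uv nth_index.
rewrite -(nth_map w0 (f v)) ?ltV // gt (nth_map v) ?nth_index ?mem_enum //.
by rewrite index_mem mem_enum.
Qed.

Lemma count_codom (V : finType) (T : eqType) (f : V -> T) t :
  count_mem t (codom f) = #|[pred v | f v == t]|.
Proof. by rewrite codomE count_map -sum1_count enumT sum1_card. Qed.

(** [fiber_bijection] is applied twice: first to match the labels of parts of equal size, then to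
    match the vertices along the relabelled parts. *)
Lemma part_sizes_bijection (V W I J : finType) (c : V -> I) (d : W -> J) :
  perm_eq (part_sizes c) (part_sizes d) ->
  exists2 h : V -> W, bijective h & forall u v, (d (h u) == d (h v)) = (c u == c v).
Proof.
move=> /fiber_bijection[g g_bij gE].
have [|h h_bij hE] := @fiber_bijection V W J (g \o c) d.
  apply/allP => j _ /=; rewrite !count_codom.
  have [g' g'K gK] := g_bij; rewrite -[j]gK gE; apply/eqP/eq_card => v.
  by rewrite !inE /= (can_eq g'K).
by exists h => // u v; rewrite !hE (bij_eq g_bij).
Qed.

(** * Uniqueness of the multipartite graph with a given characteristic polynomial *)

Lemma part_sizes_gt0 (V I : finType) (c : V -> I) :
  (forall a, exists v, c v = a) -> all (leq 1) (part_sizes c).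
Proof.
move=> c_surj; apply/allP => _ /codomP[a ->]; apply/card_gt0P.
by have [v <-] := c_surj a; exists v; rewrite inE.
Qed.

Lemma char_poly_multipartite (V I : finType) (G : sgraph V) (c : V -> I) :
  (forall u v, G u v = (c u != c v)) ->
  ('X^#|I| * char_poly (signed_mx G) =
   'X^#|V| * quotient_poly algC (part_sizes c))%R.
Proof. by move=> /signed_mx_multipartite ->; apply: char_poly_part_mx. Qed.

Lemma multipartite_unique (V W I J : finType) (G : sgraph V) (H : sgraph W)
    (c : V -> I) (d : W -> J) p :
  (forall u v, G u v = (c u != c v)) -> (forall u v, H u v = (d u != d v)) ->
  (forall a, exists v, c v = a) -> (forall b, exists w, d w = b) ->
  2 < count_mem p (part_sizes c) ->
  char_poly (signed_mx G) = char_poly (signed_mx H) -> isomorphic H G.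
Proof.
move=> Gc Hd c_surj d_surj p3 eGH.
have eVW : #|V| = #|W|.
  by apply/succn_inj; rewrite -(size_char_poly (signed_mx G)) eGH size_char_poly.
have e : perm_eq (part_sizes c) (part_sizes d).
  apply: (part_sizes_unique (part_sizes_gt0 c_surj) (part_sizes_gt0 d_surj) p3).
  have XV_neq0 : ('X^#|V| != 0 :> {poly algC})%R.
    by rewrite -size_poly_eq0 size_polyXn.
  rewrite !size_image; apply: (mulfI XV_neq0); rewrite mulrCA.
  rewrite -(char_poly_multipartite Gc) eGH mulrCA (char_poly_multipartite Hd).
  by rewrite eVW mulrCA.
have [h h_bij hE] : exists2 h : W -> V, bijective h &
    forall u v, (c (h u) == c (h v)) = (d u == d v).
  by apply: part_sizes_bijection; rewrite perm_sym.
by exists h => // u v; rewrite Gc Hd hE.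
Qed.

(** The labels from [switch_multipartite] range over all sets of vertices; discarding the unattained
    ones leaves only parts of positive size. *)
Lemma corestrict_surjective (V : finType) (T : finType) (c : V -> T) :
  exists (I : finType) (d : V -> I),
    (forall u v, (d u == d v) = (c u == c v)) /\ (forall a, exists v, d v = a).
Proof.
exists (seq_sub (codom c)), (fun v => SeqSub (codom_f c v)); split=> [//|[a aP]].
by have [v av] := codomP aP; exists v; apply/val_inj.
Qed.

(** * Part sizes of the given graph, and the conclusion *)

Section CompleteMultipartiteParts.
Variables (s : nat) (r n : 'I_s -> nat).

Lemma cmp_part_surjective : (forall i, 0 < n i) ->
  forall a, exists v, @cmp_part s r n v = a.
Proof.
move=> n_gt0 [i q].
by exists (Tagged (fun i => 'I_(r i) * 'I_(n i))%type (q, Ordinal (n_gt0 i))).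
Qed.

Lemma card_cmp_part i (q : 'I_(r i)) :
  #|[pred v | @cmp_part s r n v == Tagged (fun i => 'I_(r i)) q]| = n i.
Proof.
pose h (x : 'I_(n i)) : cmp_vertex r n :=
  Tagged (fun i => 'I_(r i) * 'I_(n i))%type (q, x).
have h_inj : injective h by move=> x y /eqP; rewrite eq_Tagged => /eqP[].
rewrite -[RHS]card_ord -(card_codom h_inj); apply: eq_card => v; rewrite !inE.
apply/eqP/codomP => [|[x ->] //].
case: v => j [q' x] e; have ji : j = i by apply: (congr1 tag e).
move: q' x e; rewrite ji => q' x /eqP; rewrite eq_Tagged => /eqP /= ->.
by exists x.
Qed.

Lemma count_cmp_part_sizes i : r i <= count_mem (n i) (part_sizes (@cmp_part s r n)).
Proof.
rewrite count_codom -[leqLHS]card_ord.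
have T_inj : injective (Tagged (fun i => 'I_(r i)) (i := i)).
  by move=> x y /eqP; rewrite eq_Tagged => /eqP.
rewrite -(card_codom T_inj); apply/subset_leq_card/subsetP => _ /codomP[q ->].
by rewrite inE card_cmp_part.
Qed.

End CompleteMultipartiteParts.

Theorem theorem3p4 (s : nat) (n r : 'I_s -> nat)
  (n_pos : forall i, 0 < n i) (n_distinct : injective n)
  (r_pos : forall i, 0 < r i) (r_ge3 : exists i, 3 <= r i) :
  S_determined (complete_multipartite r n).
Proof.
move=> W H /same_spectrum_char_poly eS.
have [i ri3] := r_ge3; set G := complete_multipartite r n.
have eM : char_poly (signed_mx H) = char_poly (signed_mx G).
  by rewrite /signed_mx !char_poly_shift eS.
have GE u v : G u v = (cmp_part u != cmp_part v) by [].
have H_le1 : neg_index (signed_mx H) <= 1.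
  rewrite (eq_neg_index (signed_mx_herm H) (signed_mx_herm G) eM).
  exact: neg_index_multipartite GE.
have [U [c HU]] := switch_multipartite H_le1.
have [I [d [dE d_surj]]] := corestrict_surjective c.
exists (switch H U); last by exists U.
apply: (multipartite_unique GE _ (cmp_part_surjective n_pos) d_surj).
- by move=> u v; rewrite HU dE.
- exact: leq_trans ri3 (count_cmp_part_sizes r n i).
- by rewrite char_poly_switch eM.
Qed.
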